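(* Let $\Gamma=(\gamma_1,\dots,\gamma_r)$ be a tuple of symmetric free polynomials in $x=(x_1,\dots,x_g)$ with $g\le r$ and $\gamma_j=x_j$ for $1\le j\le g$. Suppose $\mathcal K\subseteq \mathbb S(\mathbb C)^g$ is closed, $\Gamma$-convex, contains $0$, and $\Gamma(0)=0$. If the matrix convex hull of $\Gamma(\mathcal K)\subseteq\mathbb S(\mathbb C)^r$ is closed and if $Y\in\mathbb S_\ell(\mathbb C)^g\setminus\mathcal K(\ell)$, then there is a monic $\Gamma$-pencil $L$ of size $\ell$ such that $L(X)\succeq 0$ for all $X\in\mathcal K$, but $L(Y)$ is not positive semidefinite.
   Context: Free polynomials are elements of the free algebra $\mathbb C\langle x\rangle$ in noncommuting variables $x_1,\dots,x_g$, with the conjugate-linear involution fixing each $x_j$ and reversing words; $p$ is symmetric if $p^*=p$. $\mathbb S_n(\mathbb C)$ is the set of self-adjoint $n\times n$ complex matrices, $\mathbb S_n(\mathbb C)^g$ the set of $g$-tuples of such, and $\mathbb S(\mathbb C)^g=(\mathbb S_n(\mathbb C)^g)_{n\ge1}$. Free polynomials are evaluated at $X\in\mathbb S_n(\mathbb C)^g$ in the obvious way; $\Gamma(X)=(\gamma_1(X),\dots,\gamma_r(X))\in\mathbb S_n(\mathbb C)^r$. A subset $\mathcal K\subseteq\mathbb S(\mathbb C)^g$ is a sequence $(\mathcal K(n))_n$ with $\mathcal K(n)\subseteq\mathbb S_n(\mathbb C)^g$; closed means each $\mathcal K(n)$ is closed; $\Gamma(\mathcal K)=(\{\Gamma(X):X\in\mathcal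 K(n)\})_n$. $\mathcal K$ is a free set if it is closed under direct sums, simultaneous unitary similarity ($X\mapsto U^*XU=(U^*X_1U,\dots,U^*X_gU)$), and restriction to reducing subspaces. A $\Gamma$-pair is $(X,V)$ with $X\in\mathbb S_n(\mathbb C)^g$ and $V:\mathbb C^m\to\mathbb C^n$ an isometry such that $V^*\Gamma(X)V=\Gamma(V^*XV)$ (coordinatewise). $\mathcal K$ is $\Gamma$-convex if it is free and $V^*XV\in\mathcal K$ whenever $X\in\mathcal K$ and $(X,V)$ is a $\Gamma$-pair. Matrix convex means $\Gamma$-convex for $\Gamma(x)=x$, i.e. free and closed under compressions $X\mapsto V^*XV$ by all isometries. The matrix convex hull of a set is the intersection of all matrix convex sets containing it. A monic $\Gamma$-pencil of size $d$ is $L(x)=I_d+\sum_{j=1}^r A_j\gamma_j(x)$ with $A_j\in\mathbb S_d(\mathbb C)$, evaluated by $L(X)=I_d\otimes I_n+\sum_j A_j\otimes\gamma_j(X)$ for $X\in\mathbb S_n(\mathbb C)^g$. *)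

(* Defs.v *)
From HB Require Import structures.
From mathcomp Require Import all_boot all_order all_algebra.
From mathcomp Require Import finmap sesquilinear spectral.
From mathcomp Require Import complex mxtens.
From mathcomp Require Import monalg.
From mathcomp Require Import boolp classical_sets functions reals topology.
From mathcomp Require Import normedtype.

Set Implicit Arguments.
Unset Strict Implicit.
Unset Printing Implicit Defensive.

Import Order.TTheory GRing.Theory Num.Theory.
Import numFieldNormedType.Exports.

Local Open Scope classical_set_scope.
Local Open Scope ring_scope.
Local Open Scope sesquilinear_scope.

(* The definitions are generic in [C : numClosedFieldType], whose library
   topology is the one induced by the modulus; they are meant for
   [C := R[i]] with [R : realType]. *)

(* The free algebra C<x_1, ..., x_g>: [{fmonom I}] is the (noncommutative)
   free monoid of words over [I]. *)
Notation free_poly C g := {malg C[{fmonom 'I_g}]}.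

Section FreePolynomials.
Variable C : numClosedFieldType.

Definition fvar (g : nat) (i : 'I_g) : free_poly C g := << fmu i >>.

Definition fstar (g : nat) (p : free_poly C g) : free_poly C g :=
  \sum_(w <- msupp p) << (p@_w)^* *g FMonom (rev w) >>.

Definition fsymmetric (g : nat) (p : free_poly C g) : Prop := fstar p = p.

Definition feval (g n : nat) (p : free_poly C g) (X : 'I_g -> 'M[C]_n) :
    'M[C]_n :=
  \sum_(w <- msupp p) p@_w *: \prod_(i <- (w : seq 'I_g)) X i.

Definition feval_tuple (g r n : nat) (Gam : 'I_r -> free_poly C g)
    (X : 'I_g -> 'M[C]_n) : 'I_r -> 'M[C]_n :=
  fun j => feval (Gam j) X.

End FreePolynomials.

Section MatrixTuples.
Variable C : numClosedFieldType.

Definition selfadjoint_tuple (g n : nat) (X : 'I_g -> 'M[C]_n) : Prop :=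
  forall j, X j \is hermsymmx.

Definition dsum (g m n : nat) (X : 'I_g -> 'M[C]_m) (Y : 'I_g -> 'M[C]_n) :
    'I_g -> 'M[C]_(m + n) :=
  fun j => block_mx (X j) 0 0 (Y j).

Definition compress (g m n : nat) (V : 'M[C]_(n, m)) (X : 'I_g -> 'M[C]_n) :
    'I_g -> 'M[C]_m :=
  fun j => V^t* *m X j *m V.

Definition isometry_mx (m n : nat) (V : 'M[C]_(n, m)) : Prop :=
  V^t* *m V = 1%:M.

(* The column space of [V] is invariant under each [X j] and its adjoint. *)
Definition reducing (g m n : nat) (V : 'M[C]_(n, m)) (X : 'I_g -> 'M[C]_n) :
    Prop :=
  forall j, (exists B : 'M[C]_m, X j *m V = V *m B) /\
            (exists B : 'M[C]_m, (X j)^t* *m V = V *m B).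

Definition psd (n : nat) (A : 'M[C]_n) : Prop :=
  A \is hermsymmx /\ forall v : 'cV[C]_n, 0 <= (v^t* *m A *m v) 0 0.

End MatrixTuples.

(* A family (K(n))_n of sets of g-tuples of n x n matrices.  Only the sizes
   n >= 1 are meaningful; the component at n = 0 is never inspected. *)
Definition mxsets (C : numClosedFieldType) (g : nat) : Type :=
  forall n : nat, set ('I_g -> 'M[C]_n).

Section FreeSets.
Variable C : numClosedFieldType.

(* Closedness refers to the product topology on g-tuples of matrices; as the
   self-adjoint tuples form a closed subset, this agrees with closedness
   inside the space of self-adjoint tuples. *)
Definition closed_mxsets (g : nat) (K : mxsets C g) : Prop :=
  forall n, (0 < n)%N -> closed (K n : set {ptws 'I_g -> 'M[C]_n}).

Definition sub_mxsets (g : nat) (K T : mxsets C g) : Prop :=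
  forall n, (0 < n)%N -> K n `<=` T n.

Definition image_mxsets (g r : nat) (Gam : 'I_r -> free_poly C g)
    (K : mxsets C g) : mxsets C r :=
  fun n => feval_tuple Gam @` K n.

(* In [free_reducing] the columns of [V] are an orthonormal basis of the
   reducing subspace, so [compress V X] is the matrix of the restriction. *)
Record free_set (g : nat) (K : mxsets C g) : Prop := FreeSet {
  free_selfadjoint : forall n (X : 'I_g -> 'M[C]_n),
    (0 < n)%N -> K n X -> selfadjoint_tuple X;
  free_dsum : forall m n (X : 'I_g -> 'M[C]_m) (Y : 'I_g -> 'M[C]_n),
    (0 < m)%N -> (0 < n)%N -> K m X -> K n Y -> K (m + n)%N (dsum X Y);
  free_unitary : forall n (X : 'I_g -> 'M[C]_n) (U : 'M[C]_n),
    (0 < n)%N -> U \is unitarymx -> K n X -> K n (compress U X);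
  free_reducing : forall m n (X : 'I_g -> 'M[C]_n) (V : 'M[C]_(n, m)),
    (0 < m)%N -> (0 < n)%N -> isometry_mx V -> reducing V X ->
    K n X -> K m (compress V X)
}.

Definition gamma_pair (g r m n : nat) (Gam : 'I_r -> free_poly C g)
    (X : 'I_g -> 'M[C]_n) (V : 'M[C]_(n, m)) : Prop :=
  [/\ selfadjoint_tuple X, isometry_mx V &
      forall j, compress V (feval_tuple Gam X) j =
                feval_tuple Gam (compress V X) j].

Definition gamma_convex (g r : nat) (Gam : 'I_r -> free_poly C g)
    (K : mxsets C g) : Prop :=
  free_set K /\
  forall m n (X : 'I_g -> 'M[C]_n) (V : 'M[C]_(n, m)),
    (0 < m)%N -> (0 < n)%N ->
    K n X -> gamma_pair Gam X V -> K m (compress V X).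

Definition matrix_convex (g : nat) (K : mxsets C g) : Prop :=
  gamma_convex (@fvar C g) K.

Definition matrix_convex_hull (g : nat) (K : mxsets C g) : mxsets C g :=
  fun n => \bigcap_(T in [set T | matrix_convex T /\ sub_mxsets K T]) T n.

(* The evaluation L(X) of the monic pencil with coefficients [A]. *)
Definition pencil_eval (g r d n : nat) (Gam : 'I_r -> free_poly C g)
    (A : 'I_r -> 'M[C]_d) (X : 'I_g -> 'M[C]_n) : 'M[C]_(d * n) :=
  tensmx 1%:M 1%:M + \sum_(j < r) tensmx (A j) (feval (Gam j) X).

End FreeSets.

(* Main.v *)
(** The compressions [V* Gam(X) V] of tuples [X] in [K] by isometries [V] form
    a matrix convex set, hence contain the hull of [Gam(K)]; as [Gam] starts
    with the variables, [Gam(Y) = V* Gam(X) V] forces [Y = V* X V], so [(X,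
    V)] is a Gam-pair and [Y] lies in [K]. Thus [Gam(Y)] is not in the hull.

    The pairs [(V* V, V* Gam(X) V)], for [X] in [K] and arbitrary matrices
    [V], form a convex cone, because [K] has direct sums. Since compressing by
    a contraction stays in the hull and the hull is closed, the point [(1,
    Gam(Y))] has positive distance to this cone. A separating functional is a
    pair [(S, B)] with [tr (S V* V) + sum_j tr (B_j V* Gam_j(X) V) >= 0] on
    the cone and a negative value at [(1, Gam(Y))]. Taking [X = 0] shows that
    [S] is positive semidefinite; after adding a small multiple of the
    identity, [S = H H*] with [H] invertible, and the substitution [V = W
    H^-1] turns the inequality into positivity of a monic pencil. *)

Require Import Defs.
From mathcomp Require Import all_boot all_order all_algebra.
From mathcomp Require Import finmap sesquilinear spectral complex mxtens monalg.
From mathcomp Require Import boolp classical_sets functions reals topology.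
From mathcomp Require Import normedtype derive ring lra.

Set Implicit Arguments.
Unset Strict Implicit.
Unset Printing Implicit Defensive.

Import Order.TTheory GRing.Theory Num.Theory.
Import numFieldNormedType.Exports.

Local Open Scope classical_set_scope.
Local Open Scope ring_scope.
Local Open Scope sesquilinear_scope.

(** * Adjoints, compressions and isometries *)

Section Adjoint.
Variable C : numClosedFieldType.

Lemma hermsymmxP n (A : 'M[C]_n) : reflect (A^t* = A) (A \is hermsymmx).
Proof.
by apply: (iffP (is_hermitianmxP _ _ _)); rewrite expr0 scale1r => /esym.
Qed.

Lemma adjmxM m n p (A : 'M[C]_(m, n)) (B : 'M[C]_(n, p)) :
  (A *m B)^t* = B^t* *m A^t*.
Proof. by rewrite trmx_mul map_mxM. Qed.

Lemma adjmx1 n : (1%:M : 'M[C]_n)^t* = 1%:M.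
Proof. by rewrite trmx1 map_mx1. Qed.

Lemma adjmx0 m n : (0 : 'M[C]_(m, n))^t* = 0.
Proof. by rewrite trmx0 map_mx0. Qed.

Lemma adjmxD m n (A B : 'M[C]_(m, n)) : (A + B)^t* = A^t* + B^t*.
Proof. by rewrite linearD map_mxD. Qed.

Lemma adjmxZ m n a (A : 'M[C]_(m, n)) : (a *: A)^t* = a^* *: A^t*.
Proof. by rewrite linearZ map_mxZ. Qed.

Lemma adjmx_sum m n (I : Type) (s : seq I) (P : pred I)
    (F : I -> 'M[C]_(m, n)) :
  (\sum_(i <- s | P i) F i)^t* = \sum_(i <- s | P i) (F i)^t*.
Proof. exact: (big_morph _ (@adjmxD m n) (adjmx0 m n)). Qed.

Lemma adjmx_prod n (I : Type) (s : seq I) (F : I -> 'M[C]_n) :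
  (\prod_(i <- s) F i)^t* = \prod_(i <- rev s) (F i)^t*.
Proof.
elim: s => [|i s IH]; first by rewrite !big_nil adjmx1.
rewrite big_cons adjmxM IH rev_cons -cats1 big_cat big_seq1; congr (_ *m _).
Qed.

Lemma adjmx_block m1 m2 n1 n2 (A : 'M[C]_(m1, n1)) (B : 'M[C]_(m1, n2))
    (D : 'M[C]_(m2, n1)) (E : 'M[C]_(m2, n2)) :
  (block_mx A B D E)^t* = block_mx (A^t*) (D^t*) (B^t*) (E^t*).
Proof. by rewrite tr_block_mx map_block_mx. Qed.

Lemma adjmx_col m1 m2 n (A : 'M[C]_(m1, n)) (B : 'M[C]_(m2, n)) :
  (col_mx A B)^t* = row_mx (A^t*) (B^t*).
Proof. by rewrite tr_col_mx map_row_mx. Qed.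

Lemma mxtrace_adj n (A : 'M[C]_n) : \tr (A^t*) = (\tr A)^*.
Proof. by rewrite trace_map_mx mxtrace_tr. Qed.

(** Stacking turns direct sums into sums of compressions; this is what later makes the cone closed
    under addition. *)
Lemma compress_col_dsum g m n p (V : 'M[C]_(m, p)) (W : 'M[C]_(n, p))
    (X : 'I_g -> 'M[C]_m) (Y : 'I_g -> 'M[C]_n) (j : 'I_g) :
  compress (col_mx V W) (dsum X Y) j = compress V X j + compress W Y j.
Proof.
rewrite /compress /dsum adjmx_col mul_row_block.
by rewrite !mulmx0 addr0 add0r mul_row_col.
Qed.

Lemma compress_block_dsum g m n p q (V : 'M[C]_(m, p)) (W : 'M[C]_(n, q))
    (X : 'I_g -> 'M[C]_m) (Y : 'I_g -> 'M[C]_n) :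
  compress (block_mx V 0 0 W) (dsum X Y) = dsum (compress V X) (compress W Y).
Proof.
apply/funext => j; rewrite /compress /dsum adjmx_block !adjmx0 !mulmx_block.
by rewrite !(mulmx0, mul0mx, addr0, add0r).
Qed.

Lemma compress_comp g m n p (V : 'M[C]_(n, m)) (W : 'M[C]_(p, n))
    (X : 'I_g -> 'M[C]_p) :
  compress V (compress W X) = compress (W *m V) X.
Proof. by apply/funext => j; rewrite /compress adjmxM !mulmxA. Qed.

Lemma compress1 g n (X : 'I_g -> 'M[C]_n) : compress 1%:M X = X.
Proof. by apply/funext => j; rewrite /compress adjmx1 mul1mx mulmx1. Qed.

Lemma isometry_mx_comp m n p (V : 'M[C]_(n, m)) (W : 'M[C]_(p, n)) :
  isometry_mx V -> isometry_mx W -> isometry_mx (W *m V).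
Proof.
move=> hV hW; rewrite /isometry_mx adjmxM mulmxA -(mulmxA _ _ W).
by rewrite hW mulmx1 hV.
Qed.

Lemma isometry_mx1 n : isometry_mx (1%:M : 'M[C]_n).
Proof. by rewrite /isometry_mx adjmx1 mulmx1. Qed.

Lemma unitarymx_isometry n (U : 'M[C]_n) : U \is unitarymx -> isometry_mx U.
Proof. by move=> /unitarymxP /mulmx1C. Qed.

Lemma selfadjoint_compress g m n (V : 'M[C]_(n, m)) (X : 'I_g -> 'M[C]_n) :
  selfadjoint_tuple X -> selfadjoint_tuple (compress V X).
Proof.
move=> hX j; apply/hermsymmxP; rewrite /compress !adjmxM trmxCK mulmxA.
by have /hermsymmxP -> := hX j.
Qed.

End Adjoint.

(** * Free polynomials at direct sums and at self-adjoint tuples *)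

Section Evaluation.
Variables (C : numClosedFieldType) (g : nat).

Lemma feval_fvar n (i : 'I_g) (X : 'I_g -> 'M[C]_n) : feval (fvar C i) X = X i.
Proof.
rewrite /feval /fvar msuppU1 big_seq_fset1 mcoeffUU scale1r.
by rewrite /fmu fmE big_seq1.
Qed.

Lemma prod_dsum m n (X : 'I_g -> 'M[C]_m) (Y : 'I_g -> 'M[C]_n) (w : seq 'I_g) :
  \prod_(i <- w) dsum X Y i =
  block_mx (\prod_(i <- w) X i) 0 0 (\prod_(i <- w) Y i).
Proof.
elim: w => [|i w IH]; first by rewrite !big_nil -[1]/(1%:M) -scalar_mx_block.
rewrite !big_cons IH -mulmxE mulmx_block.
by rewrite !(mulmx0, mul0mx, addr0, add0r).
Qed.

Lemma feval_dsum m n (p : free_poly C g) (X : 'I_g -> 'M[C]_m)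
    (Y : 'I_g -> 'M[C]_n) :
  feval p (dsum X Y) = block_mx (feval p X) 0 0 (feval p Y).
Proof.
rewrite /feval; elim/big_rec3: _ => [|w x y z _ ->]; first by rewrite block_mx0.
by rewrite prod_dsum scale_block_mx !scaler0 add_block_mx !addr0.
Qed.

Lemma feval_tuple_dsum r m n (Gam : 'I_r -> free_poly C g)
    (X : 'I_g -> 'M[C]_m) (Y : 'I_g -> 'M[C]_n) :
  feval_tuple Gam (dsum X Y) = dsum (feval_tuple Gam X) (feval_tuple Gam Y).
Proof. by apply/funext => j; rewrite /feval_tuple feval_dsum. Qed.

(** Reversal is injective, so among the words of [p] only [w] can contribute to the coefficient of
    [fstar p] at the reversed word. *)
Lemma fsymmetric_coeff (p : free_poly C g) (w : {fmonom 'I_g}) :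
  fsymmetric p -> p@_(FMonom (rev w)) = (p@_w)^*.
Proof.
move=> hp; rewrite -[in LHS]hp /fstar (raddf_sum (mcoeff _)).
have eqr (u : {fmonom 'I_g}) : (FMonom (rev u) == FMonom (rev w)) = (u == w).
  apply/eqP/eqP => [[/(congr1 rev)]|-> //].
  by rewrite !revK; case: u w => [u] [w] /= ->.
transitivity (\sum_(u <- msupp p) if u == w then (p@_w)^* else 0).
  by apply: eq_bigr => u _ /=; rewrite mcoeffU eqr; case: eqP => [->|].
(* Off the support of [p] both sides vanish. *)
case: msuppP => [hw|hw].
  rewrite (big_fsetD1 w) //= eqxx big1_seq ?addr0 // => u /andP[_].
  by rewrite in_fsetD1 => /andP[/negbTE ->].
by rewrite conjC0 big1 // => u _; case: ifP.
Qed.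

(** The adjoint of a word in self-adjoint matrices is the reversed word, and reversal permutes the
    support of a symmetric [p] while conjugating its coefficients. *)
Lemma feval_hermsymmx n (p : free_poly C g) (X : 'I_g -> 'M[C]_n) :
  fsymmetric p -> selfadjoint_tuple X -> feval p X \is hermsymmx.
Proof.
move=> hp hX; apply/hermsymmxP; rewrite /feval adjmx_sum.
pose rw (w : {fmonom 'I_g}) : {fmonom 'I_g} := FMonom (rev w).
have rwK : involutive rw by case=> w; rewrite /rw /= revK.
have rw_supp : perm_eq (map rw (msupp p)) (msupp p).
  apply: uniq_perm; rewrite ?(map_inj_uniq (inv_inj rwK)) ?fset_uniq // => w.
  rewrite -[w in LHS]rwK (mem_map (inv_inj rwK)) -!mcoeff_neq0.
  by rewrite fsymmetric_coeff // conjC_eq0.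
rewrite -[RHS](perm_big _ rw_supp) /= big_map; apply: eq_bigr => w _.
rewrite adjmxZ adjmx_prod fsymmetric_coeff //; congr (_ *: _).
by apply: eq_bigr => i _; have /hermsymmxP := hX i.
Qed.

Lemma selfadjoint_feval_tuple r n (Gam : 'I_r -> free_poly C g)
    (X : 'I_g -> 'M[C]_n) :
  (forall j, fsymmetric (Gam j)) -> selfadjoint_tuple X ->
  selfadjoint_tuple (feval_tuple Gam X).
Proof. by move=> hGam hX j; apply: feval_hermsymmx. Qed.

End Evaluation.

(** * Positive semidefinite matrices and the quadratic form of a pencil *)

Section PositiveSemidefinite.
Variable C : numClosedFieldType.

(** By the spectral theorem [A = U^* D U] with [D >= 0] diagonal; take [H = U^* sqrt D]. *)
Lemma psd_factor n (A : 'M[C]_n) : psd A -> exists H : 'M[C]_n, A = H *m H^t*.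
Proof.
move=> [hA pA]; have := hermitian_normalmx hA.
move=> /orthomx_spectralP.
set U := spectralmx A; set d := spectral_diag A => eA.
have uU : U \is unitarymx by apply: spectral_unitarymx.
have UU : U *m U^t* = 1%:M by apply/unitarymxP.
have dE : diag_mx d = U *m A *m U^t*.
  by rewrite [in RHS]eA invmx_unitary // !mulmxA UU mul1mx -mulmxA UU mulmx1.
have d_ge0 i : 0 <= d 0 i.
  have -> : d 0 i = (diag_mx d) i i by rewrite !mxE eqxx.
  have := pA ((row i U)^t*); rewrite trmxCK dE -row_mul.
  by congr (_ <= _); rewrite !mxE; apply: eq_bigr => k _; rewrite !mxE.
pose s : 'rV[C]_n := \row_i sqrtC (d 0 i).
exists (U^t* *m diag_mx s).
rewrite adjmxM trmxCK mulmxA -(mulmxA _ (diag_mx s)).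
rewrite [LHS]eA invmx_unitary //; congr (_ *m _ *m _).
apply/matrixP => i j; rewrite !mxE (bigD1 i) //= big1 => [|k /negbTE ki].
  rewrite !mxE eqxx mulr1n addr0 eq_sym.
  case: eqP => [->|]; rewrite ?mulr0n ?mulr1n.
    by rewrite conj_Creal ?ger0_real ?sqrtC_ge0 // -expr2 sqrtCK.
  by rewrite conjC0 mulr0.
by rewrite !mxE eq_sym ki mulr0n mul0r.
Qed.

Lemma sum_norm_sqr_le n (v : 'cV[C]_n) :
  \sum_i \sum_j `|v i 0| * `|v j 0| <= n%:R * \sum_i `|v i 0| ^+ 2.
Proof.
have amgm (x y : C) : 0 <= x -> 0 <= y -> x * y <= (x ^+ 2 + y ^+ 2) / 2.
  move=> x0 y0; rewrite ler_pdivlMr // -subr_ge0.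
  have -> : x ^+ 2 + y ^+ 2 - x * y * 2 = (x - y) ^+ 2 by ring.
  by rewrite real_exprn_even_ge0 // rpredB // ger0_real.
pose S := \sum_i `|v i 0| ^+ 2.
apply: (@le_trans _ _ (\sum_i \sum_j (`|v i 0| ^+ 2 + `|v j 0| ^+ 2) / 2)).
  by do 2![apply: ler_sum => ? _]; apply: amgm.
have -> : \sum_i \sum_j (`|v i 0| ^+ 2 + `|v j 0| ^+ 2) / 2 = n%:R * S.
  under eq_bigr => i _ do rewrite -mulr_suml big_split /= sumr_const card_ord.
  rewrite -mulr_suml big_split /= sumr_const card_ord sumrMnl -/S.
  by rewrite -mulr2n -[_ *+ 2]mulr_natr mulfK ?pnatr_eq0 // mulr_natl.
by [].
Qed.

(** Entrywise smallness becomes an operator bound: [|v^* E v| <= e (sum |v_i|)^2 <= n e |v|^2], the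
    last inequality by [sum_norm_sqr_le]. *)
Lemma psd_scalar_sub n (E : 'M[C]_n) (e : C) :
  0 <= e -> E \is hermsymmx -> (forall i j, `|E i j| <= e) ->
  psd ((n%:R * e)%:M - E).
Proof.
move=> e0 /hermsymmxP hE leE; split.
  apply/hermsymmxP; rewrite adjmxD -scalemx1 adjmxZ adjmx1; congr (_ + _).
    by rewrite conj_Creal // ger0_real // mulr_ge0 // ler0n.
  by rewrite -scaleN1r adjmxZ hE conjCN1.
move=> v; rewrite mulmxBr mulmxBl mul_mx_scalar -scalemxAl !mxE subr_ge0.
have -> : \sum_j (v^t*) 0 j * v j 0 = \sum_j `|v j 0| ^+ 2.
  by apply: eq_bigr => j _; rewrite !mxE normCK mulrC.
set x := \sum_j _; have hx : x = (v^t* *m E *m v) 0 0 by rewrite [RHS]mxE.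
(* The order on [C] is partial: [x] can be bounded by its modulus only once it is known to be
   real. *)
have xr : x \is Num.real.
  apply/CrealP; rewrite hx.
  have hh : (v^t* *m E *m v)^t* = v^t* *m E *m v.
    by rewrite !adjmxM trmxCK hE mulmxA.
  by rewrite -[in RHS]hh [RHS]mxE [in RHS]mxE.
apply: le_trans (real_ler_norm xr) _.
rewrite hx -mulmxA mxE; apply: le_trans (ler_norm_sum _ _ _) _.
apply: (@le_trans _ _ (e * \sum_i \sum_j `|v i 0| * `|v j 0|)).
  rewrite mulr_sumr; apply: ler_sum => i _; rewrite !mxE normrM norm_conjC.
  rewrite mulr_sumr (le_trans (ler_wpM2l _ (ler_norm_sum _ _ _))) //.
  rewrite mulr_sumr; apply: ler_sum => j _.
  by rewrite normrM [leRHS]mulrCA ler_wpM2l // ler_wpM2r.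
by rewrite -mulrA mulrCA ler_wpM2l // sum_norm_sqr_le.
Qed.

(** The functional with coefficients [S], [B] at the pair formed by [V^* V] and the compression of
    [Z]. For [S = 1] it is the quadratic form of a monic pencil, [V] being the test vector in matrix
    shape. *)
Definition pencil_form r d n (S : 'M[C]_d) (B : 'I_r -> 'M[C]_d)
    (Z : 'I_r -> 'M[C]_n) (V : 'M[C]_(n, d)) : C :=
  \tr (S *m (V^t* *m V)) + \sum_j \tr (B j *m compress V Z j).

(* [v] is the vectorization of [W]. *)
Lemma tensmx_form d n (A : 'M[C]_d) (Z : 'M[C]_n) (v : 'cV[C]_(d * n))
    (W : 'M[C]_(n, d)) : (forall p j, W p j = v (mxtens_index (j, p)) 0) ->
  (v^t* *m tensmx A Z *m v) 0 0 = \tr (A^T *m (W^t* *m Z *m W)).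
Proof.
move=> hW.
have big_tens (F : 'I_(d * n) -> C) :
    \sum_k F k = \sum_i \sum_p F (mxtens_index (i, p)).
  rewrite pair_bigA /= (reindex (@mxtens_index d n)) /=.
    by apply: eq_bigr => -[].
  exists (@mxtens_unindex d n) => k _; first exact: mxtens_indexK.
  exact: mxtens_unindexK.
rewrite mxE big_tens /mxtrace; apply: eq_bigr => j _; rewrite [RHS]mxE.
under eq_bigr => q _ do rewrite mxE mulr_suml big_tens.
rewrite exchange_big /=; apply: eq_bigr => i _; rewrite !mxE mulr_sumr.
apply: eq_bigr => q _; rewrite !mxE mulr_suml mulr_sumr; apply: eq_bigr => p _.
by rewrite tensmxE !mxE !hW; ring.
Qed.

(** The transposes come from the vectorization: the first tensor factor acts on the column index of
    [W]. *)
Lemma pencil_form_tens r d n (A : 'I_r -> 'M[C]_d) (Z : 'I_r -> 'M[C]_n)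
    (v : 'cV[C]_(d * n)) (W : 'M[C]_(n, d)) :
  (forall p j, W p j = v (mxtens_index (j, p)) 0) ->
  (v^t* *m (tensmx 1%:M 1%:M + \sum_j tensmx (A j) (Z j)) *m v) 0 0 =
  pencil_form 1%:M (fun j => (A j)^T) Z W.
Proof.
move=> hW; rewrite mulmxDr mulmxDl mulmx_sumr mulmx_suml mxE summxE.
rewrite (tensmx_form _ _ hW) trmx1 mulmx1; congr (_ + _).
by apply: eq_bigr => j _; rewrite (tensmx_form _ _ hW).
Qed.

(** The substitution [V -> V H] normalizes the constant coefficient [H H^*] to [1], by cyclicity of
    the trace. *)
Lemma pencil_form_congr r d n (H : 'M[C]_d) (B : 'I_r -> 'M[C]_d)
    (Z : 'I_r -> 'M[C]_n) (V : 'M[C]_(n, d)) : H \in unitmx ->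
  pencil_form 1%:M (fun j => invmx H *m B j *m (invmx H)^t*) Z (V *m H) =
  pencil_form (H *m H^t*) B Z V.
Proof.
move=> uH; have eH : (invmx H)^t* *m H^t* = 1%:M.
  by rewrite -adjmxM mulmxV // adjmx1.
rewrite /pencil_form mul1mx adjmxM; congr (_ + _).
  by rewrite -(mulmxA H) [RHS]mxtrace_mulC !mulmxA.
apply: eq_bigr => j _; rewrite -!mulmxA [LHS]mxtrace_mulC /compress adjmxM.
rewrite -!mulmxA mulmxV // mulmx1; do ?[congr (\tr _)].
by rewrite [in LHS](mulmxA ((invmx H)^t*)) eH mul1mx !mulmxA.
Qed.

Lemma tensmx_hermsymmx m n (A : 'M[C]_m) (Z : 'M[C]_n) :
  A \is hermsymmx -> Z \is hermsymmx -> tensmx A Z \is hermsymmx.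
Proof.
move=> /hermsymmxP hA /hermsymmxP hZ; apply/hermsymmxP.
by rewrite trmx_tens map_mxT hA hZ.
Qed.

(** Writing [S = H H^*] with [H] invertible, [V -> V H] is a bijection of test matrices, so
    positivity of the form for [(S, B)] is positivity of the monic pencil with coefficients the
    transposes of [H^-1 B_j H^-*]. *)
Lemma monic_pencil_of_form r d (S : 'M[C]_d) (B : 'I_r -> 'M[C]_d) :
  psd S -> S \in unitmx -> (forall j, B j \is hermsymmx) ->
  exists2 A : 'I_r -> 'M[C]_d, forall j, A j \is hermsymmx &
    forall n (Z : 'I_r -> 'M[C]_n), selfadjoint_tuple Z ->
      psd (tensmx 1%:M 1%:M + \sum_j tensmx (A j) (Z j)) <->
      forall V : 'M[C]_(n, d), 0 <= pencil_form S B Z V.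
Proof.
move=> /psd_factor[H ->]; rewrite unitmx_mul => /andP[uH _] hB.
pose A j := (invmx H *m B j *m (invmx H)^t*)^T.
have hA j : A j \is hermsymmx.
  apply/hermsymmxP; rewrite /A -map_trmx; congr (_^T).
  by rewrite !adjmxM trmxCK mulmxA; have /hermsymmxP -> := hB j.
have eA (n : nat) (Z : 'I_r -> 'M[C]_n) V :
    pencil_form 1%:M (fun j => (A j)^T) Z (V *m H) =
    pencil_form (H *m H^t*) B Z V.
  rewrite -pencil_form_congr //; congr (_ + _).
  by apply: eq_bigr => j _; rewrite trmxK.
exists A => // n Z hZ; split=> [[_ pL] V|pV].
  pose v : 'cV[C]_(d * n) :=
    \col_k (V *m H) (mxtens_unindex k).2 (mxtens_unindex k).1.
  rewrite -eA -(@pencil_form_tens _ _ _ A Z v) // => p j.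
  by rewrite [RHS]mxE mxtens_indexK.
split=> [|v].
  apply/hermsymmxP; rewrite adjmxD adjmx_sum; congr (_ + _).
    by apply/hermsymmxP; apply: tensmx_hermsymmx; apply/hermsymmxP/adjmx1.
  by apply: eq_bigr => j _; apply/hermsymmxP/tensmx_hermsymmx.
pose W : 'M[C]_(n, d) := \matrix_(p, j) v (mxtens_index (j, p)) 0.
rewrite (@pencil_form_tens _ _ _ A Z v W) => [|p j]; last by rewrite mxE.
by rewrite -[W](mulmxKV uH) eA.
Qed.

End PositiveSemidefinite.

(** * Separating a convex set from the origin in real coordinates *)

Section Separation.
Variable R : realType.

Let sqn n (x : 'rV[R]_n) := \sum_i x 0 i ^+ 2.
Let dot n (x y : 'rV[R]_n) := \sum_i x 0 i * y 0 i.

Let sqn_ge0 n (x : 'rV[R]_n) : 0 <= sqn x.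
Proof. by apply: sumr_ge0 => i _; exact: sqr_ge0. Qed.

Let sqnDZ n (x y : 'rV[R]_n) t :
  sqn (x + t *: (y - x)) =
  sqn x + t * (2 * (dot x y - sqn x) + t * sqn (y - x)).
Proof.
rewrite /sqn /dot mulr_sumr -sumrB mulr_sumr -big_split mulr_sumr -big_split /=.
by apply: eq_bigr => i _; rewrite !mxE; ring.
Qed.

Let sqn_continuous n : continuous (@sqn n).
Proof.
rewrite /sqn; elim: (index_enum _) => [|i s IH] x.
  by under eq_fun do rewrite big_nil; exact: cst_continuous.
under eq_fun do rewrite big_cons expr2.
have ci : (fun y : 'rV[R]_n => y 0 i) @ x --> x 0 i by exact: coord_continuous.
exact: (cvgD (cvgM ci ci) (IH x)).
Qed.

(** The point [c] of least Euclidean norm in the closure of [S] serves as the normal vector, with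
    [d = |c|^2]. *)
Lemma strict_separation n (S : set 'rV[R]_n) (e : R) :
  S !=set0 ->
  (forall (x y : 'rV[R]_n) (t : R), S x -> S y -> 0 <= t <= 1 ->
     S (x + t *: (y - x))) ->
  0 < e -> (forall x : 'rV[R]_n, S x -> exists i, e <= `|x 0 i|) ->
  exists c : 'rV[R]_n, exists2 d : R, 0 < d &
    forall x : 'rV[R]_n, S x -> d <= \sum_i c 0 i * x 0 i.
Proof.
move=> [x0 Sx0] convS e0 farS.
(* The closure is cut down to a compact set; as it contains [x0], a minimum over [A] is a minimum
   over the whole closure. *)
pose A := closure S `&` [set x | sqn x <= sqn x0].
have closedA : closed A.
  apply: closedI; first exact: closed_closure.
  apply: (@preimage_closed _ _ (@sqn n) [set y | y <= sqn x0]) => [x _|].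
    exact: sqn_continuous.
  exact: closed_le.
have boundedA : bounded_set A.
  exists (sqn x0 + 1); split; first exact: num_real.
  move=> M ltM x [_ /= hx]; apply/ltW/(le_lt_trans _ ltM).
  rewrite [leLHS]/Num.norm /= mx_normrE; apply: bigmax_le => [|[i j] _] /=.
    by rewrite addr_ge0 ?sqn_ge0.
  rewrite (ord1 i); have : `|x 0 j| ^+ 2 <= sqn x0.
    apply: le_trans hx; rewrite real_normK ?num_real //.
    rewrite /sqn (bigD1 j) //= lerDl.
    by apply: sumr_ge0 => k _; exact: sqr_ge0.
  (* Here [2 |x_j| <= |x_j|^2 + 1] bounds a coordinate by its square. *)
  by have := sqn_ge0 x0; have := sqr_ge0 (`|x 0 j| - 1); lra.
have A0 : A !=set0 by exists x0; split; [exact: subset_closure | exact: lexx].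
have [c /set_mem[clc cx0] minc] :
    exists2 c, c \in A & forall t, t \in A -> sqn c <= sqn t.
  apply: (EVT_min_rV A0 (bounded_closed_compact boundedA closedA)).
  by apply: continuous_subspaceT; exact: sqn_continuous.
have {}minc x : closure S x -> sqn c <= sqn x.
  move=> clx; have [xx0|/ltW xx0] := leP (sqn x) (sqn x0).
    by apply: minc; apply/mem_set; split.
  exact: le_trans xx0.
have c_gt0 : 0 < sqn c.
  rewrite lt0r sqn_ge0 andbT; apply/eqP => c0.
  have {}c0 : c = 0.
    apply/rowP => i; rewrite mxE; apply/eqP; rewrite -sqrf_eq0; apply/eqP.
    by move/psumr_eq0P : c0 => -> // j _; exact: sqr_ge0.
  move: clc => /(_ _ (nbhsx_ballx c e e0)) [x [Sx [_ xe]]].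
  have [k] := farS _ Sx; rewrite leNgt => /negP; apply.
  by have := xe 0 k; rewrite c0 mxE /ball /= sub0r normrN.
(* [c] is the point of the closure of [S] closest to the origin. *)
exists c; exists (sqn c) => // x Sx.
rewrite -/(dot c x) leNgt; apply/negP => lt.
have cl_seg t : 0 <= t <= 1 -> closure S (c + t *: (x - c)).
  move=> t01 B /nbhs_ballP[a a0 aB].
  have [y [Sy [_ ya]]] := clc _ (nbhsx_ballx c a a0).
  exists (y + t *: (x - y)); split; first exact: convS.
  apply: aB; split=> // k j; apply: le_lt_trans (ya k j); rewrite !mxE.
  have -> : c k j + t * (x k j - c k j) - (y k j + t * (x k j - y k j)) =
            (1 - t) * (c k j - y k j) by ring.
  by rewrite normrM ler_piMl // ler_norml; lra.
(* Moving from [c] towards [x] by [t] changes the squared norm by [t (t Q - 2 D)]. For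
   [t = D / (D + Q)] one has [t <= 1] and [t Q <= D], so the change is negative; the denominator is
   positive even when [Q = 0]. *)
pose D := sqn c - dot c x; pose Q := sqn (x - c).
have D0 : 0 < D by rewrite /D subr_gt0.
have Q0 : 0 <= Q by exact: sqn_ge0.
have DQ0 : 0 < D + Q by rewrite ltr_pwDl.
have t0 : 0 < D / (D + Q) by rewrite divr_gt0.
have tQ : D / (D + Q) * Q <= D.
  by rewrite mulrAC ler_pdivrMr // ler_pM2l // lerDr ltW.
have /cl_seg/minc : 0 <= D / (D + Q) <= 1.
  by rewrite (ltW t0) ler_pdivrMr // mul1r lerDl.
rewrite sqnDZ lerDl pmulr_rge0 // -/Q => h.
have : 2 * (- D) + D / (D + Q) * Q < 0 by lra.
by rewrite /D opprB ltNge h.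
Qed.

End Separation.

(** * The same separation for tuples of complex matrices *)

Section MatrixSeparation.
Variable R : realType.

Lemma Re_sum (I : finType) (F : I -> R[i]) :
  complex.Re (\sum_k F k) = \sum_k complex.Re (F k).
Proof. by apply: (big_morph (@complex.Re R)) => [[a b] [c d]|]. Qed.

Lemma separation_mx (I : finType) l (S : set (I -> 'M[R[i]]_l)) (e : R) :
  S !=set0 ->
  (forall (M N : I -> 'M[R[i]]_l) (t : R), S M -> S N -> 0 <= t <= 1 ->
     S (fun k => M k + t%:C%C *: (N k - M k))) ->
  0 < e ->
  (forall M : I -> 'M[R[i]]_l, S M ->
     exists k, exists i, exists j, e%:C%C <= `|M k i j|) ->
  exists c : I -> 'M[R[i]]_l, exists2 d : R, 0 < d &
    forall M : I -> 'M[R[i]]_l, S M ->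
      d <= complex.Re (\sum_k \tr (c k *m M k)).
Proof.
move=> S0 convS e0 farS.
(* Real coordinates: tuple index, column, row, and a boolean choosing the real or imaginary part.
   Column precedes row to match the expansion of [tr (c M)]. *)
pose J := ((I * 'I_l) * 'I_l * bool)%type.
pose coord (M : I -> 'M[R[i]]_l) (x : J) : R :=
  let z := M x.1.1.1 x.1.2 x.1.1.2 in
  if x.2 then complex.Re z else complex.Im z.
pose f M : 'rV[R]_#|{: J}| := \row_k coord M (enum_val k).
have fE M (x : J) : f M 0 (enum_rank x) = coord M x.
  by rewrite mxE enum_rankK.
have [| | | |c [d d0 hc]] := @strict_separation R _ (f @` S) (e / 2).
- by case: S0 => M SM; exists (f M); exists M.
- move=> _ _ t [M SM <-] [N SN <-] t01.
  exists (fun k => M k + t%:C%C *: (N k - M k)); first exact: convS.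
  apply/rowP => k; rewrite !mxE /coord !mxE.
  case: (enum_val k) => -[[k' j] i] [] /=;
    case: (M k' i j) => a b; case: (N k' i j) => a' b' /=; ring.
- by rewrite divr_gt0.
- move=> _ [M /farS[k [i0 [j ej]]] <-].
  set z := M k i0 j in ej.
  have {ej} : e <= `|complex.Re z| + `|complex.Im z|.
    rewrite -lecR; apply: le_trans ej _; rewrite [z in leLHS]complexE.
    apply: le_trans (ler_normD _ _) _; rewrite normrM.
    rewrite rmorphD /= lerD //; last rewrite -[leRHS]mul1r.
      by rewrite normc_def /= expr0n addr0 sqrtr_sqr.
    by rewrite !normc_def /= expr0n !(addr0, add0r) expr1n sqrtr1 sqrtr_sqr.
  (* As [|Re z| + |Im z| >= e], one of the two parts is at least [e / 2]. *)
  have [le_z _|lt_z ez] := leP (e / 2) `|complex.Re z|.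
    by exists (enum_rank ((k, j), i0, true)); rewrite fE.
  by exists (enum_rank ((k, j), i0, false)); rewrite fE /coord /= -/z; lra.
(* The imaginary part enters with a minus sign since [Re ((a - i b) (x + i y)) = a x + b y]. *)
pose cx k j i b := c 0 (enum_rank ((k, j), i, b)).
exists (fun k => \matrix_(j, i) (cx k j i true -i* cx k j i false)%C), d => //.
move=> M SM; apply: le_trans (hc (f M) _) _; first by exists M.
rewrite le_eqVlt; apply/orP; left; apply/eqP.
rewrite Re_sum (reindex (@enum_rank J)); last exact/onW_bij/enum_rank_bij.
transitivity (\sum_k \sum_j \sum_i \sum_b cx k j i b * coord M (k, j, i, b)).
  rewrite !pair_bigA; apply: eq_bigr => -[[[k j] i] b] _ /=; by rewrite fE.
apply: eq_bigr => k _; rewrite /mxtrace Re_sum; apply: eq_bigr => j _.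
rewrite mxE Re_sum; apply: eq_bigr => i _; rewrite big_bool /coord /= !mxE.
by case: (M k i j) => a b /=; ring.
Qed.

End MatrixSeparation.

(** * Distance from a point to a closed set of tuples *)

Section ClosedSets.
Variable C : numClosedFieldType.

(** Otherwise the boxes around [Z], intersected with [T], generate a proper filter on [T] converging
    to [Z], which puts [Z] in the closed set [T]. *)
Lemma closed_ptws_far r l (T : set {ptws 'I_r -> 'M[C]_l})
    (Z : 'I_r -> 'M[C]_l) :
  closed T -> ~ T Z -> exists2 e : C, 0 < e &
    forall W : 'I_r -> 'M[C]_l, T W ->
      exists j, exists a, exists b, e <= `|W j a b - Z j a b|.
Proof.
move=> closedT TZ; apply: contrapT => far.
pose box (e : C) := [set W : {ptws 'I_r -> 'M[C]_l} |
  T W /\ forall j a b, `|W j a b - Z j a b| < e].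
have box_neq0 e : 0 < e -> box e !=set0.
  move=> e0; apply: contrapT => nW; apply: far; exists e => // W TW.
  apply: contrapT => nfar; apply: nW; exists W; split=> // j a b.
  rewrite real_ltNge ?normr_real ?gtr0_real //.
  by apply/negP => le; apply: nfar; exists j, a, b.
have min_gt0 (e e' : C) :
    0 < e -> 0 < e' -> exists2 m, 0 < m & m <= e /\ m <= e'.
  move=> e0 e0'; have [ee'|e'e] := real_leP (gtr0_real e0) (gtr0_real e0').
    by exists e.
  by exists e' => //; rewrite lexx ltW.
pose F := filter_from [set e : C | 0 < e] box.
have FF : ProperFilter F.
  apply: filter_from_proper => [|e]; last exact: box_neq0.
  apply: filter_from_filter; first by exists 1 => /=; rewrite ltr01.
  move=> e e' e0 e0'; have [m m0 [me me']] := min_gt0 e e' e0 e0'.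
  exists m => // W [TW hW]; split; split=> // j a b.
    exact: lt_le_trans (hW j a b) me.
  exact: lt_le_trans (hW j a b) me'.
apply: TZ; suff FZ : id @ F --> (Z : {ptws 'I_r -> 'M[C]_l}).
  apply: (closed_cvg _ closedT _ _ FZ).
  by exists 1 => [/=|W []]; rewrite ?ltr01.
(* The pointwise topology is a supremum of coordinate topologies, so convergence is checked one
   coordinate at a time. *)
apply/cvg_sup => j U [V [[W oW <-] WZ WU]].
have /nbhs_ballP[e e0 eW] : nbhs (Z j) W by exact: open_nbhs_nbhs.
exists e => // Y [_ hY]; apply: WU; apply: eW; split=> // a b.
by rewrite /ball /= distrC.
Qed.
End ClosedSets.

(** * The matrix convex hull as a set of compressions *)

Section Hull.
Variables (C : numClosedFieldType) (g r : nat).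
Variables (Gam : 'I_r -> free_poly C g) (K : mxsets C g).

(** The explicit form of the hull of [Gam(K)]: [hull_sub_compressions] and [compressions_sub_hull]
    give the two inclusions. *)
Definition compressions : mxsets C r := fun m Z =>
  exists n (X : 'I_g -> 'M[C]_n) (V : 'M[C]_(n, m)),
    [/\ (0 < n)%N, K X, isometry_mx V & Z = compress V (feval_tuple Gam X)].

Lemma compressions_isometry m n (Z : 'I_r -> 'M[C]_n) (V : 'M[C]_(n, m)) :
  isometry_mx V -> compressions Z -> compressions (compress V Z).
Proof.
move=> hV [N [X [W [N0 KX hW ->]]]]; exists N, X, (W *m V); split=> //.
  exact: isometry_mx_comp.
by rewrite compress_comp.
Qed.

Lemma matrix_convex_compressions :
  (forall j, fsymmetric (Gam j)) -> free_set K -> matrix_convex compressions.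
Proof.
move=> hGam hK; split; last first.
  by move=> m n Z V _ _ TZ [_ hV _]; exact: compressions_isometry.
split.
- move=> n _ _ [N [X [W [N0 KX hW ->]]]].
  apply/selfadjoint_compress/selfadjoint_feval_tuple => //.
  exact: free_selfadjoint KX.
- move=> m n _ _ _ _ [M [X [V [M0 KX hV ->]]]] [N [Y [W [N0 KY hW ->]]]].
  exists (M + N)%N, (dsum X Y), (block_mx V 0 0 W); split.
  + by rewrite addn_gt0 M0.
  + exact: free_dsum.
  + rewrite /isometry_mx adjmx_block !adjmx0 mulmx_block hV hW.
    by rewrite !(mulmx0, mul0mx, addr0, add0r) -scalar_mx_block.
  + by rewrite feval_tuple_dsum compress_block_dsum.
- move=> n Z U _ /unitarymx_isometry hU; exact: compressions_isometry.
- by move=> m n Z V _ _ hV _; exact: compressions_isometry.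
Qed.

Lemma hull_sub_compressions :
  (forall j, fsymmetric (Gam j)) -> free_set K ->
  forall n (Z : 'I_r -> 'M[C]_n), (0 < n)%N ->
    matrix_convex_hull (image_mxsets Gam K) Z -> compressions Z.
Proof.
move=> hGam hK n Z n0; apply; split; first exact: matrix_convex_compressions.
move=> N N0 _ [X KX <-]; exists N, X, 1%:M; split=> //.
  exact: isometry_mx1.
by rewrite compress1.
Qed.

Lemma compressions_sub_hull :
  (forall j, fsymmetric (Gam j)) -> free_set K ->
  forall n (Z : 'I_r -> 'M[C]_n), (0 < n)%N ->
    compressions Z -> matrix_convex_hull (image_mxsets Gam K) Z.
Proof.
move=> hGam hK m _ m0 [n [X [V [n0 KX hV ->]]]] T [[hT cvxT] KT].
apply: (cvxT _ _ (feval_tuple Gam X) V) => //.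
  by apply: KT => //; exists X.
split=> // [|j]; last by rewrite /compress /feval_tuple !feval_fvar.
exact/selfadjoint_feval_tuple/(free_selfadjoint hK n0 KX).
Qed.

(** Both hypotheses concern size one; larger zero tuples are direct sums of copies of that one. *)
Lemma free_zero l : free_set K -> K (fun _ : 'I_g => 0 : 'M[C]_1) ->
  (forall j, feval (Gam j) (fun _ : 'I_g => 0 : 'M[C]_1) = 0) ->
  K (fun _ : 'I_g => 0 : 'M[C]_l.+1) /\
  feval_tuple Gam (fun _ : 'I_g => 0 : 'M[C]_l.+1) = fun=> 0.
Proof.
move=> hK K0 Gam0; elim: l => [|l [Kl Gaml]].
  by split=> //; apply/funext => j; exact: Gam0.
have -> : (fun _ : 'I_g => 0 : 'M[C]_(1 + l.+1)) =
          dsum (fun=> 0 : 'M[C]_1) (fun=> 0 : 'M[C]_l.+1).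
  by apply/funext => j; rewrite /dsum block_mx0.
split; first exact: free_dsum.
rewrite (@feval_tuple_dsum _ _ _ 1 l.+1 Gam (fun=> 0) (fun=> 0)) Gaml.
apply/funext => j.
by rewrite /dsum /feval_tuple Gam0 block_mx0.
Qed.

(* A contraction [V] is the upper part of an isometry [col_mx V Q], which
   compresses [dsum X 0] to the same tuple as [V] compresses [X]. *)
Lemma contraction_hull n l (X : 'I_g -> 'M[C]_n) (V : 'M[C]_(n, l)) :
  (forall j, fsymmetric (Gam j)) -> free_set K ->
  K (fun _ : 'I_g => 0 : 'M[C]_1) ->
  (forall j, feval (Gam j) (fun _ : 'I_g => 0 : 'M[C]_1) = 0) ->
  (0 < n)%N -> (0 < l)%N -> K X -> psd (1%:M - V^t* *m V) ->
  matrix_convex_hull (image_mxsets Gam K) (compress V (feval_tuple Gam X)).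
Proof.
move=> hGam hK K0 Gam0 n0; case: l V => // l V _ KX /psd_factor[Q hQ].
have [Kl Gaml] := free_zero l hK K0 Gam0.
apply: compressions_sub_hull => //.
exists (n + l.+1)%N, (dsum X (fun=> 0)), (col_mx V (Q^t*)); split.
- by rewrite addn_gt0 n0.
- exact: free_dsum.
- by rewrite /isometry_mx adjmx_col mul_row_col trmxCK -hQ addrC subrK.
- rewrite feval_tuple_dsum Gaml; apply/funext => j.
  by rewrite compress_col_dsum /compress mulmx0 mul0mx addr0.
Qed.

(** The first [g] coordinates of [Gam(Y) = V^* Gam(X) V] read [Y = V^* X V]; then all of them say
    that [(X, V)] is a [Gam]-pair. *)
Lemma feval_notin_hull (hgr : (g <= r)%N) l (Y : 'I_g -> 'M[C]_l) :
  (forall j, fsymmetric (Gam j)) ->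
  (forall j, Gam (widen_ord hgr j) = fvar C j) ->
  gamma_convex Gam K -> (0 < l)%N -> ~ K Y ->
  ~ matrix_convex_hull (image_mxsets Gam K) (feval_tuple Gam Y).
Proof.
move=> hGam hvar [hK cvxK] l0 KY hullY.
have [n [X [V [n0 KX hV eY]]]] := hull_sub_compressions hGam hK l0 hullY.
have eYV : Y = compress V X.
  apply/funext => j; have := congr1 (fun Z => Z (widen_ord hgr j)) eY.
  by rewrite /compress /feval_tuple hvar !feval_fvar.
apply: KY; rewrite eYV; apply: cvxK => //; split=> // [|j].
  exact: free_selfadjoint KX.
by rewrite -eYV eY.
Qed.

End Hull.

(** * The cone of compressed pairs and its distance to the target point *)

Section PencilCone.
Variable C : numClosedFieldType.

Lemma psdZ n (a : C) (A : 'M[C]_n) : 0 <= a -> psd A -> psd (a *: A).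
Proof.
move=> a0 [/hermsymmxP hA pA]; split=> [|v].
  by apply/hermsymmxP; rewrite adjmxZ hA conj_Creal ?ger0_real.
by rewrite -scalemxAr -scalemxAl mxE mulr_ge0.
Qed.

Lemma psdD n (A B : 'M[C]_n) : psd A -> psd B -> psd (A + B).
Proof.
move=> [/hermsymmxP hA pA] [/hermsymmxP hB pB]; split=> [|v].
  by apply/hermsymmxP; rewrite adjmxD hA hB.
by rewrite mulmxDr mulmxDl mxE addr_ge0.
Qed.

Lemma mxtrace_adj_mul m n (V : 'M[C]_(m, n)) :
  \tr (V^t* *m V) = \sum_j \sum_i `|V i j| ^+ 2.
Proof.
rewrite /mxtrace; apply: eq_bigr => j _; rewrite mxE; apply: eq_bigr => i _.
by rewrite !mxE normCK mulrC.
Qed.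

Lemma mxtrace_adj_mul_ge0 m n (V : 'M[C]_(m, n)) : 0 <= \tr (V^t* *m V).
Proof.
by rewrite mxtrace_adj_mul; do 2![apply: sumr_ge0 => ? _]; rewrite exprn_ge0.
Qed.

Lemma psd1 n : psd (1%:M : 'M[C]_n).
Proof.
split=> [|v]; first exact/hermsymmxP/adjmx1.
by rewrite mulmx1 -trace_mx11 mxtrace_adj_mul_ge0.
Qed.

(** A row [u] in the kernel satisfies [u S u^* + a u u^* = 0] with both terms nonnegative, so
    [u = 0]. *)
Lemma psd_add_scalar_unit n (S : 'M[C]_n) (a : C) :
  psd S -> 0 < a -> S + a *: 1%:M \in unitmx.
Proof.
move=> [_ pS] a0; rewrite -row_free_unit -kermx_eq0.
apply/rowV0P => u /sub_kermxP uS.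
have : (u *m (S + a *: 1%:M) *m u^t*) 0 0 = 0 by rewrite uS mul0mx mxE.
rewrite mulmxDr mulmxDl -scalemxAr -scalemxAl mulmx1 mxE [X in _ + X]mxE.
have := pS (u^t*); rewrite trmxCK => uS0; move/eqP; rewrite paddr_eq0 //.
  move=> /andP[_]; rewrite mulf_eq0 gt_eqF //= => /eqP.
  rewrite mxE => /psumr_eq0P u0; apply/rowP => j; rewrite mxE; apply/eqP.
  rewrite -normr_eq0 -sqrf_eq0 normCK; have := u0 _ j isT; rewrite !mxE.
  by move=> -> // k _; rewrite !mxE mul_conjC_ge0.
by rewrite pmulr_rge0 // -trace_mx11 -[u in u *m _]trmxCK mxtrace_adj_mul_ge0.
Qed.

(* The pair [(V* V, (V* Z_j V)_j)] as a tuple of length [r + 1], entry [0]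
   being [V* V]. *)
Definition cone_point r l n (V : 'M[C]_(n, l)) (Z : 'I_r -> 'M[C]_n)
    (k : 'I_r.+1) : 'M[C]_l :=
  if unlift ord0 k is Some j then compress V Z j else V^t* *m V.

Lemma cone_point_col r l m n (V : 'M[C]_(m, l)) (W : 'M[C]_(n, l))
    (X : 'I_r -> 'M[C]_m) (Y : 'I_r -> 'M[C]_n) k :
  cone_point (col_mx V W) (dsum X Y) k = cone_point V X k + cone_point W Y k.
Proof.
rewrite /cone_point; case: unliftP => [j _|_]; first exact: compress_col_dsum.
by rewrite adjmx_col mul_row_col.
Qed.

Lemma cone_pointZ r l n (a : C) (V : 'M[C]_(n, l)) (Z : 'I_r -> 'M[C]_n) k :
  0 <= a -> cone_point (sqrtC a *: V) Z k = a *: cone_point V Z k.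
Proof.
move=> a0; have sa : (sqrtC a)^* = sqrtC a.
  by rewrite conj_Creal ?ger0_real ?sqrtC_ge0.
rewrite /cone_point /compress; case: unliftP => [j _|_];
  by rewrite adjmxZ sa -?scalemxAl -scalemxAr -?scalemxAl scalerA -expr2 sqrtCK.
Qed.

Lemma cone_point1 r l (Z : 'I_r -> 'M[C]_l) j :
  cone_point 1%:M Z (lift ord0 j) = Z j.
Proof. by rewrite /cone_point liftK compress1. Qed.

Lemma cone_point_ord0 r l n (V : 'M[C]_(n, l)) (Z : 'I_r -> 'M[C]_n) :
  cone_point V Z ord0 = V^t* *m V.
Proof. by rewrite /cone_point unlift_none. Qed.

Lemma cone_point_lift r l n (V : 'M[C]_(n, l)) (Z : 'I_r -> 'M[C]_n) j :
  cone_point V Z (lift ord0 j) = compress V Z j.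
Proof. by rewrite /cone_point liftK. Qed.

Lemma cone_point_herm r l n (V : 'M[C]_(n, l)) (Z : 'I_r -> 'M[C]_n) k :
  selfadjoint_tuple Z -> cone_point V Z k \is hermsymmx.
Proof.
move=> hZ; rewrite /cone_point; case: unliftP => [j _|_].
  exact: selfadjoint_compress.
by apply/hermsymmxP; rewrite adjmxM trmxCK.
Qed.

Lemma pencil_form_cone r l n (c : 'I_r.+1 -> 'M[C]_l) (V : 'M[C]_(n, l))
    (Z : 'I_r -> 'M[C]_n) :
  pencil_form (c ord0) (fun j => c (lift ord0 j)) Z V =
  \sum_k \tr (c k *m cone_point V Z k).
Proof.
rewrite big_ord_recl /pencil_form cone_point_ord0; congr (_ + _).
by apply: eq_bigr => j _; rewrite cone_point_lift.
Qed.

(** A cone point too close to [(1, Z)] would yield, after shrinking [V] to a contraction, a hull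
    point closer to [Z] than closedness allows. *)
Lemma cone_point_far g r (Gam : 'I_r -> free_poly C g) (K : mxsets C g) l
    (Z : 'I_r -> 'M[C]_l) :
  (forall j, fsymmetric (Gam j)) -> free_set K ->
  K 1%N (fun _ : 'I_g => 0 : 'M[C]_1) ->
  (forall j, feval (Gam j) (fun _ : 'I_g => 0 : 'M[C]_1) = 0) ->
  closed_mxsets (matrix_convex_hull (image_mxsets Gam K)) ->
  (0 < l)%N -> ~ matrix_convex_hull (image_mxsets Gam K) Z ->
  exists2 e : C, 0 < e & forall n (X : 'I_g -> 'M[C]_n) (V : 'M[C]_(n, l)),
    (0 < n)%N -> K n X -> exists k, exists a, exists b,
      e <= `|(cone_point V (feval_tuple Gam X) k - cone_point 1%:M Z k) a b|.
Proof.
move=> hGam hK K0 Gam0 hcl l0 hullZ.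
have [d d0 far] := closed_ptws_far (hcl l l0) hullZ.
pose M := \sum_j \sum_a \sum_b `|Z j a b|.
have leM j a b : `|Z j a b| <= M.
  rewrite /M (bigD1 j) //= (bigD1 a) //= (bigD1 b) //= -!addrA lerDl.
  by rewrite !addr_ge0 // ?sumr_ge0 // => *; do ?[apply: sumr_ge0 => *].
have M0 : 0 <= M by do 3![apply: sumr_ge0 => ? _].
have N0 : 0 < 1 + l%:R * M by rewrite ltr_pwDl // mulr_ge0.
(* If [V* V] is within [e] of [1], then [V] divided by the square root of
   [s = 1 + l e] is a contraction; the scaling moves a point within [e] of [Z]
   to a point within [e + l e M = d] of [Z]. *)
pose e := d / (1 + l%:R * M); have e0 : 0 < e by rewrite divr_gt0.
exists e => // n X V n0 KX; apply: contrapT => near.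
have {}near k a b :
    `|(cone_point V (feval_tuple Gam X) k - cone_point 1%:M Z k) a b| < e.
  rewrite real_ltNge ?normr_real ?gtr0_real //.
  by apply/negP => le; apply: near; exists k, a, b.
pose s := 1 + l%:R * e; have s0 : 0 < s by rewrite ltr_pwDl // mulr_ge0 // ltW.
have s1 : 1 <= s by rewrite lerDl mulr_ge0 // ltW.
have sV0 : 0 <= s^-1 by rewrite invr_ge0 ltW.
pose W := sqrtC s^-1 *: V.
have pW : psd (1%:M - W^t* *m W).
  rewrite -(@cone_point_ord0 r _ _ _ (feval_tuple Gam X)) cone_pointZ //.
  have := cone_point_ord0 V (feval_tuple Gam X).
  set P := cone_point _ _ _ => eP.
  (* The entries of [P - 1] are below [e], so [psd_scalar_sub] applies to the right-hand side. *)
  have -> : 1%:M - s^-1 *: P = s^-1 *: ((l%:R * e)%:M - (P - 1%:M)).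
    have es : (l%:R * e)%:M + 1%:M = s%:M :> 'M[C]_l by rewrite -raddfD addrC.
    by rewrite opprB addrA es scalerBr scale_scalar_mx mulVf // gt_eqF.
  apply: psdZ => //; apply: psd_scalar_sub; first exact: ltW.
    apply/hermsymmxP; rewrite adjmxD -scaleN1r adjmxZ conjCN1 adjmx1 scaleN1r.
    by rewrite eP adjmxM trmxCK.
  move=> a b; have := near ord0 a b.
  by rewrite -/P [cone_point 1%:M _ _]cone_point_ord0 adjmx1 mulmx1 => /ltW.
have hullW := contraction_hull hGam hK K0 Gam0 n0 l0 KX pW.
have [j [a [b]]] := far _ hullW.
apply/negP; rewrite -real_ltNge ?normr_real ?gtr0_real //.
rewrite -(cone_point_lift W) cone_pointZ // cone_point_lift.
have := near (lift ord0 j) a b; rewrite cone_point1 cone_point_lift.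
move: (compress V _ j) => P; rewrite !mxE.
move: (P a b) (leM j a b); set z := Z j a b => p le_z pz.
have -> : s^-1 * p - z = s^-1 * ((p - z) - l%:R * e * z).
  rewrite /s; field; by rewrite gt_eqF.
rewrite normrM ger0_norm // mulrC ltr_pdivrMr //.
apply: (@lt_le_trans _ _ d); last by rewrite ler_peMr // ltW.
apply: le_lt_trans (ler_normB _ _) _.
have -> : d = e + l%:R * e * M by rewrite /e; field; rewrite gt_eqF.
apply: ltr_leD => //; have le0 : 0 <= l%:R * e by rewrite mulr_ge0 // ltW.
by rewrite normrM ger0_norm // ler_wpM2l.
Qed.

End PencilCone.

(** * From the separating functional to Hermitian coefficients *)

Section SeparatingForm.
Variable R : realType.
Local Notation C := R[i].

(** For Hermitian [M] the trace of [c^* M] is the conjugate of that of [c M]. Hence the coefficients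
    can be made Hermitian without changing the real functional. *)
Lemma mxtrace_herm_part l (c M : 'M[C]_l) : M \is hermsymmx ->
  \tr ((2^-1 *: (c + c^t*)) *m M) = 'Re (\tr (c *m M)).
Proof.
move=> /hermsymmxP hM; rewrite -scalemxAl mxtraceZ mulmxDl mxtraceD.
by rewrite -[in X in _ + X]hM -adjmxM mxtrace_adj mxtrace_mulC ReE mulrC.
Qed.

(** Strict separation from the origin is applied to the cone translated by [-(1, Z)]. *)
Lemma separating_form g r (Gam : 'I_r -> free_poly C g) (K : mxsets C g) l
    (Z : 'I_r -> 'M[C]_l) :
  (forall j, fsymmetric (Gam j)) -> free_set K ->
  K 1%N (fun _ : 'I_g => 0 : 'M[C]_1) ->
  (forall j, feval (Gam j) (fun _ : 'I_g => 0 : 'M[C]_1) = 0) ->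
  closed_mxsets (matrix_convex_hull (image_mxsets Gam K)) ->
  (0 < l)%N -> selfadjoint_tuple Z ->
  ~ matrix_convex_hull (image_mxsets Gam K) Z ->
  exists S : 'M[C]_l, exists B : 'I_r -> 'M[C]_l,
    [/\ S \is hermsymmx, forall j, B j \is hermsymmx,
        forall n (X : 'I_g -> 'M[C]_n) (V : 'M[C]_(n, l)), (0 < n)%N -> K n X ->
          0 <= pencil_form S B (feval_tuple Gam X) V &
        pencil_form S B Z 1%:M < 0].
Proof.
move=> hGam hK K0 Gam0 hcl l0 hZ hullZ.
have [e e0 far] := cone_point_far hGam hK K0 Gam0 hcl l0 hullZ.
pose T := [set M : 'I_r.+1 -> 'M[C]_l |
  exists n (X : 'I_g -> 'M[C]_n) (V : 'M[C]_(n, l)), [/\ (0 < n)%N, K n X &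
    M = fun k => cone_point V (feval_tuple Gam X) k - cone_point 1%:M Z k]].
have eE : (complex.Re e)%:C%C = e by rewrite RRe_real // gtr0_real.
have [| | | |c [d d0 hc]] := @separation_mx R _ l T (complex.Re e).
- exists (fun k => cone_point (0 : 'M_(1, l)) (feval_tuple Gam (fun=> 0)) k -
    cone_point 1%:M Z k).
  by exists 1%N, (fun=> 0), 0.
- move=> _ _ t [m [X [V [m0 KX ->]]]] [n [Y [W [n0 KY ->]]]] /andP[t0 t1].
  pose a : C := (1 - t)%:C%C; pose b : C := t%:C%C.
  have a0 : 0 <= a by rewrite ler0c subr_ge0.
  have b0 : 0 <= b by rewrite ler0c.
  (* Square roots of the weights, because cone points are quadratic in [V]. *)
  exists (m + n)%N, (dsum X Y), (col_mx (sqrtC a *: V) (sqrtC b *: W)); split.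
  + by rewrite addn_gt0 m0.
  + exact: free_dsum.
  + apply/funext => k; rewrite feval_tuple_dsum cone_point_col !cone_pointZ //.
    have -> : a = 1 - b by rewrite /a rmorphB.
    move: (cone_point V _ k) (cone_point W _ k) (cone_point 1%:M _ k) => P Q N.
    by apply/matrixP => i j; rewrite !mxE -/b; ring.
- by rewrite -ltcR eE.
- by move=> _ [n [X [V [n0 KX ->]]]]; rewrite eE; apply: far.
pose h k := 2^-1 *: (c k + (c k)^t*).
have hh k : h k \is hermsymmx.
  apply/hermsymmxP; rewrite adjmxZ adjmxD trmxCK addrC conj_Creal //.
  by rewrite rpredV realn.
pose form n (V : 'M[C]_(n, l)) (N : 'I_r -> 'M[C]_n) : R :=
  complex.Re (\sum_k \tr (c k *m cone_point V N k)).
have formE n V (N : 'I_r -> 'M[C]_n) : selfadjoint_tuple N ->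
    pencil_form (h ord0) (fun j => h (lift ord0 j)) N V = (form n V N)%:C%C.
  move=> hN; rewrite pencil_form_cone /form complexRe raddf_sum.
  by apply: eq_bigr => k _; apply/mxtrace_herm_part/cone_point_herm.
have le_form n (X : 'I_g -> 'M[C]_n) V : (0 < n)%N -> K n X ->
    form l 1%:M Z + d <= form n V (feval_tuple Gam X).
  move=> n0 KX; have := hc _ (ex_intro _ n (ex_intro _ X (ex_intro _ V
    (And3 n0 KX erefl)))).
  under eq_bigr => k _ do rewrite mulmxBr raddfB.
  rewrite sumrB /form; move: (\sum_k _) (\sum_k _) => [x y] [x' y'] /=; lra.
have formZ n (X : 'I_g -> 'M[C]_n) V t : 0 <= t ->
    form n (sqrtC t%:C%C *: V) (feval_tuple Gam X) =
    t * form n V (feval_tuple Gam X).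
  move=> t0; rewrite /form.
  under eq_bigr => k _ do rewrite cone_pointZ ?ler0c // -scalemxAr mxtraceZ.
  by rewrite -mulr_sumr; case: (\sum_k _) => x y /=; ring.
(* A linear form bounded below on a cone is nonnegative on it. *)
have form_ge0 n (X : 'I_g -> 'M[C]_n) V : (0 < n)%N -> K n X ->
    0 <= form n V (feval_tuple Gam X).
  move=> n0 KX; rewrite leNgt; apply/negP => neg.
  pose q := form n V (feval_tuple Gam X); pose p := form l 1%:M Z.
  (* The zero matrix [V] gives the apex of the cone, where the form vanishes. *)
  have p0 : p + d <= 0.
    have := @le_form 1%N (fun=> 0) (sqrtC (0%:C%C) *: 0) isT K0.
    by rewrite formZ // mul0r.
  (* Scaling by this factor brings the value [q] to [p + d - 1], below the lower bound [p + d]. *)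
  have t0 : 0 <= (p + d - 1) / q.
    by rewrite -mulrNN -invrN divr_ge0 // oppr_ge0; [lra|exact: ltW].
  have := @le_form n X (sqrtC ((p + d - 1) / q)%:C%C *: V) n0 KX.
  by rewrite formZ // divfK ?lt_eqF // -/p; lra.
have formZ0 : form l 1%:M Z < 0.
  have := @le_form 1%N (fun=> 0) (sqrtC (0%:C%C) *: 0) isT K0.
  by rewrite formZ // mul0r; lra.
exists (h ord0), (fun j => h (lift ord0 j)); split=> //.
- move=> n X V n0 KX; rewrite formE ?ler0c ?form_ge0 //.
  exact/selfadjoint_feval_tuple/(free_selfadjoint hK n0 KX).
- by rewrite formE // ltcR.
Qed.

End SeparatingForm.

(** * Assembling the monic pencil *)

Theorem theorem1p4 (R : realType) (g r : nat)
    (Gam : 'I_r -> free_poly R[i] g) (K : mxsets R[i] g)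
    (hgr : (g <= r)%N)
    (hsym : forall j : 'I_r, fsymmetric (Gam j))
    (hvar : forall j : 'I_g, Gam (widen_ord hgr j) = fvar R[i] j)
    (hclosed : closed_mxsets K)
    (hconvex : gamma_convex Gam K)
    (hK0 : K 1%N (fun _ : 'I_g => 0))
    (hGam0 : forall j : 'I_r, feval (Gam j) (fun _ : 'I_g => 0 : 'M[R[i]]_1) = 0)
    (hhull : closed_mxsets (matrix_convex_hull (image_mxsets Gam K)))
    (l : nat) (hl : (0 < l)%N) (Y : 'I_g -> 'M[R[i]]_l)
    (hY : selfadjoint_tuple Y) (hYK : ~ K l Y) :
  exists A : 'I_r -> 'M[R[i]]_l,
    [/\ forall j : 'I_r, A j \is hermsymmx,
        forall (n : nat) (X : 'I_g -> 'M[R[i]]_n),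
          (0 < n)%N -> K n X -> psd (pencil_eval Gam A X) &
        ~ psd (pencil_eval Gam A Y)].
Proof.
have [hK _] := hconvex.
have hGY := selfadjoint_feval_tuple hsym hY.
have hullY := feval_notin_hull hsym hvar hconvex hl hYK.
have [S [B [hS hB formK formY]]] :=
  separating_form hsym hK hK0 hGam0 hhull hl hGY hullY.
have pS : psd S.
  split=> // v; have := formK _ _ (v^t*) (ltn0Sn 0) hK0.
  rewrite /pencil_form big1 => [|j _].
    by rewrite trmxCK addr0 mulmxA mxtrace_mulC mulmxA trace_mx11.
  by rewrite /compress /feval_tuple hGam0 mulmx0 mul0mx mulmx0 mxtrace0.
pose d := - pencil_form S B (feval_tuple Gam Y) 1%:M.
have d0 : 0 < d by rewrite oppr_gt0.
have l0 : 0 < l%:R :> R[i] by rewrite ltr0n.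
(* Since [tr 1 = l], adding [a] times the identity to [S] raises the value at [(1, Gam(Y))] from
   [-d] to [-d / 2], still negative. *)
pose a := d / (2 * l%:R); have a0 : 0 < a by rewrite divr_gt0 // mulr_gt0.
have formS n (Z : 'I_r -> 'M[R[i]]_n) V :
    pencil_form (S + a *: 1%:M) B Z V =
    pencil_form S B Z V + a * \tr (V^t* *m V).
  by rewrite /pencil_form mulmxDl mxtraceD -scalemxAl mxtraceZ mul1mx addrAC.
have pS' : psd (S + a *: 1%:M) by apply/psdD/psdZ/psd1 => //; exact: ltW.
have [A hA psdA] := monic_pencil_of_form pS' (psd_add_scalar_unit pS a0) hB.
exists A; split=> // [n X n0 KX|/(psdA _ _ hGY)/(_ 1%:M)].
  apply/psdA => [|V].
    exact/selfadjoint_feval_tuple/(free_selfadjoint hK n0 KX).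
  by rewrite formS addr_ge0 ?formK // mulr_ge0 ?mxtrace_adj_mul_ge0 ?ltW.
rewrite formS adjmx1 mulmx1 mxtrace1 -[pencil_form _ _ _ _]opprK -/d.
have -> : - d + a * l%:R = - (d / 2).
  by rewrite /a; field; rewrite gt_eqF.
by rewrite oppr_ge0 lt_geF ?divr_gt0.
Qed.
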